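(* Let $a$ and $b$ be positive integers, and let $\zeta$ denote the Riemann zeta function. For each $n\ge 1$ let $q_n$ be the (least) common denominator of the rational elements of the set $\{\zeta(a+b),\zeta(2a+b),\dots,\zeta(an+b)\}$. Then either there are infinitely many $n\in\mathbb{N}$ for which $\zeta(an+b)$ is irrational, or the sequence $\{q_n\}_{n=1}^\infty$ grows super-exponentially, i.e., $q_n^{1/n}\to\infty$ as $n\to\infty$.
   Context: The common denominator $q_n$ is the least positive integer $q$ such that $q\,\zeta(ak+b)\in\mathbb{Z}$ for every $k\in\{1,\dots,n\}$ for which $\zeta(ak+b)$ is rational (so $q_n=1$ if there is no such $k$). ''Either ... or'' means that at least one of the two alternatives holds. *)

(* Defs.v *)
From mathcomp Require Import all_boot all_order all_algebra.
From mathcomp Require Import all_classical all_reals all_analysis.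
Import Order.TTheory GRing.Theory Num.Theory numFieldNormedType.Exports.

Set Implicit Arguments.
Unset Strict Implicit.
Unset Printing Implicit Defensive.

Local Open Scope classical_set_scope.
Local Open Scope ring_scope.

(* The Dirichlet series \sum_(m >= 1) m^(-s); it converges, and so defines the
   Riemann zeta function, for real s > 1 only (elsewhere the value is junk). *)
Definition zeta (R : realType) (s : R) : R :=
  limn (series (fun m : nat => (m.+1%:R : R) `^ (- s))).

Definition common_denom (R : realType) (a b n q : nat) : Prop :=
  forall k : nat, (1 <= k <= n)%N ->
    rational (zeta (a * k + b)%:R : R) ->
    q%:R * (zeta (a * k + b)%:R : R) \is a Num.int.

Lemma common_denom_exists (R : realType) (a b n : nat) :
  exists q : nat, (0 < q)%N && `[< common_denom R a b n q >].
Proof.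
elim: n => [|n [q /andP[q0 /asboolP cdq]]].
  by exists 1%N; apply/andP; split=> //; apply/asboolP => -[].
have [[r _ rE]|nr] := pselect (rational (zeta (a * n.+1 + b)%:R : R)).
- have dq0 : (0 < `|denq r|)%N by rewrite absz_gt0 denq_neq0.
  exists (`|denq r| * q)%N; rewrite muln_gt0 dq0 q0 /=; apply/asboolP => k.
  rewrite [(k <= _)%N]leq_eqVlt ltnS andb_orr => /orP[/andP[k1 /eqP kn]|/andP[k1 kn]] rk.
  + rewrite kn mulnC natrM -mulrA rpredM ?rpred_nat//.
    rewrite -rE pmulrn absz_denq.
    rewrite -(ratr_int R (denq r)) -rmorphM/= mulrC -numqE ratr_int.
    exact: intr_int.
  + by rewrite natrM -mulrA rpredM ?rpred_nat// cdq// k1.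
- exists q; rewrite q0; apply/asboolP => k.
  rewrite [(k <= _)%N]leq_eqVlt ltnS andb_orr => /orP[/andP[k1 /eqP kn]|/andP[k1 kn]] rk.
  + by case: nr; rewrite -kn.
  + by apply: cdq; rewrite // k1.
Qed.

Definition q_ (R : realType) (a b n : nat) : nat :=
  ex_minn (common_denom_exists R a b n).

(* Main.v *)
(* Suppose that zeta (a k + b) is rational for all large k.  Fix M and put
   P = \prod_(1 <= j <= M) (1 - j^a X), a polynomial with integer coefficients
   vanishing at m^-a for m <= M and with values in ]0, 1] at m^-a for m > M.
   With s = a (n - M) + b, the integer linear form
     L = \sum_i P_i zeta (a i + s) = \sum_(m > M) m^-s P(m^-a)
   satisfies 0 < L <= zeta 2 * (M+1)^(2 - s), and involves only values
   zeta (a k + b) with n - M <= k <= n.  For large n, q_n L is thus a positive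
   integer, whence q_n >= c_M (M+1)^n; as M is arbitrary, q_n^(1/n) tends to
   infinity. *)
Require Import Defs.
From mathcomp Require Import all_boot all_order all_algebra.
From mathcomp Require Import all_classical all_reals all_analysis.
From mathcomp Require Import ring lra zify.
Import Order.TTheory GRing.Theory Num.Theory numFieldNormedType.Exports.

Local Open Scope classical_set_scope.
Local Open Scope ring_scope.

(** The terms are dominated by a telescoping series: [(x + 1) ^- 2 <= x^-1 - (x + 1)^-1] for
    [x > 0]. *)
Lemma cvg_series_inv_sqr (R : realType) :
  cvgn (series (fun m : nat => (m.+1%:R : R) ^- 2)).
Proof.
apply: nondecreasing_is_cvgn.
  by apply: nondecreasing_series => m _ _; rewrite invr_ge0 exprn_ge0.
exists 2 => _ [N _ <-].
(* The bound 2 alone is not inductive; subtracting the tail [N.+1%:R^-1] makes it so. *)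
suff: series (fun m : nat => (m.+1%:R : R) ^- 2) N.+1 <= 2 - N.+1%:R^-1.
  rewrite /series /= => H.
  apply: le_trans (le_trans _ H) _; last by rewrite gerBl.
  by rewrite big_nat_recr//= lerDl invr_ge0 exprn_ge0.
elim: N => [|N IH]; first by rewrite /series /= big_nat1 expr1n invr1; lra.
rewrite /series /= big_nat_recr//=; move: IH; rewrite /series /= => IH.
suff : N.+2%:R ^- 2 <= N.+1%:R^-1 - N.+2%:R^-1 :> R.
  by move: (_ ^- 2) (N.+1%:R^-1) (N.+2%:R^-1) IH => u v w; lra.
rewrite -[N.+2]addn1 natrD.
have x0 : 0 < N.+1%:R :> R by [].
move: (N.+1%:R) x0 => x x0.
have -> : x^-1 - (x + 1%:R)^-1 = (x * (x + 1%:R))^-1.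
  by field; rewrite !gt_eqF//; lra.
by rewrite lef_pV2 ?posrE; nra.
Qed.

Lemma cvg_series_zeta (R : realType) (s : nat) : (2 <= s)%N ->
  series (fun m : nat => (m.+1%:R : R) ^- s) @ \oo --> zeta (s%:R : R).
Proof.
move=> s2.
have -> : zeta (s%:R : R) = limn (series (fun m : nat => (m.+1%:R : R) ^- s)).
  rewrite /zeta; congr (limn (series _)); apply/funext => m.
  by rewrite powR_invn.
apply: series_le_cvg (cvg_series_inv_sqr R) => m //.
by rewrite lef_pV2 ?posrE ?exprn_gt0// ler_weXn2l// ler1n.
Qed.

Lemma cvg_series_lincomb (R : realType) (n : nat) (c l : nat -> R)
    (f : nat -> R^nat) : (forall i, series (f i) @ \oo --> l i) ->
  series (fun m => \sum_(i < n) c i * f i m) @ \oo --> \sum_(i < n) c i * l i.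
Proof.
move=> fl.
have -> : series (fun m => \sum_(i < n) c i * f i m) =
    fun N => \sum_(i < n) c i * series (f i) N.
  apply/funext => N; rewrite /series /= exchange_big /=.
  by apply: eq_bigr => i _; rewrite mulr_sumr.
elim: n => [|n IH].
  rewrite big_ord0 (_ : (fun N => _) = fun=> 0); first exact: cvg_cst.
  by apply/funext => N; rewrite big_ord0.
rewrite big_ord_recr /= (_ : (fun N => _) =
  (fun N => \sum_(i < n) c i * series (f i) N + c n * series (f n) N)).
  by apply: (cvgD IH); apply: cvgMl_tmp; exact: fl.
by apply/funext => N; rewrite big_ord_recr.
Qed.

(** The monomial of degree [i] in [p] shifts the exponent [s] to [a * i + s], so each coefficient
    weighs one zeta series. *)
Lemma cvg_series_zeta_poly (R : realType) (p : {poly R}) (a s : nat) :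
    (2 <= s)%N ->
  series (fun m : nat => m.+1%:R ^- s * p.[m.+1%:R ^- a]) @ \oo -->
  \sum_(i < size p) p`_i * zeta ((a * i + s)%:R : R).
Proof.
move=> s2.
rewrite (_ : (fun m => _) =
  fun m => \sum_(i < size p) p`_i * m.+1%:R ^- (a * i + s)).
  apply: (cvg_series_lincomb R (size p) (fun i => p`_i)
    (fun i => zeta ((a * i + s)%:R : R))
    (fun i m => m.+1%:R ^- (a * i + s))) => i.
  exact/cvg_series_zeta/ltn_addl.
apply/funext => m; rewrite horner_coef mulr_sumr; apply: eq_bigr => i _.
by rewrite mulrCA exprD invfM exprM exprVn [_^-1 * _^-1]mulrC.
Qed.

Definition vanish_poly (a M : nat) : {poly int} :=
  \prod_(j < M) (1 - (j.+1 ^ a)%:R *: 'X).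

(** The degree bound [M] keeps the indices [n - M + i] of the linear form at most [n], within reach
    of [q_]. *)
Lemma size_vanish_poly (a M : nat) : (size (vanish_poly a M) <= M.+1)%N.
Proof.
rewrite /vanish_poly; elim: M => [|M IH].
  by rewrite big_ord0 size_poly1.
rewrite big_ord_recr /=; apply: leq_trans (size_polyMleq _ _) _.
have : (size (1 - (M.+1 ^ a)%:R *: 'X : {poly int})%R <= 2)%N.
  apply: leq_trans (size_polyD _ _) _; rewrite geq_max size_poly1 size_polyN.
  by apply: leq_trans (size_scale_leq _ _) _; rewrite size_polyX.
by move=> /(leq_add IH); rewrite addn2 -subn1 leq_subLR add1n.
Qed.

Lemma horner_vanish_poly (R : realType) (a M : nat) (x : R) :
  (map_poly intr (vanish_poly a M)).[x] =
  \prod_(j < M) (1 - (j.+1 ^ a)%:R * x).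
Proof.
rewrite /vanish_poly rmorph_prod horner_prod; apply: eq_bigr => j _.
by rewrite rmorphB rmorph1 /= map_polyZ map_polyX !hornerE rmorph_nat.
Qed.

Lemma vanish_poly_eq0 (R : realType) (a M m : nat) : (m < M)%N ->
  (map_poly intr (vanish_poly a M)).[m.+1%:R ^- a] = 0 :> R.
Proof.
move=> mM; rewrite horner_vanish_poly (bigD1 (Ordinal mM)) //=.
by rewrite natrX mulfV ?subrr ?mul0r// expf_neq0.
Qed.

(** Each factor is [1 - (j.+1 / m.+1) ^ a] with [j.+1 <= M < m.+1]; strict positivity uses
    [0 < a]. *)
Lemma vanish_poly_itv (R : realType) (a M m : nat) : (0 < a)%N -> (M <= m)%N ->
  0 < (map_poly intr (vanish_poly a M)).[(m.+1%:R : R) ^- a] <= 1.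
Proof.
move=> a0 Mm; rewrite horner_vanish_poly.
have H (j : 'I_M) : 0 < 1 - (j.+1 ^ a)%:R * (m.+1%:R : R) ^- a <= 1.
  rewrite gerBl mulr_ge0 ?invr_ge0 ?exprn_ge0// andbT subr_gt0.
  rewrite -natrX ltr_pdivrMr ?ltr0n ?expn_gt0// mul1r ltr_nat.
  by rewrite ltn_exp2r// ltnS (leq_trans (ltn_ord j)).
apply/andP; split; first by apply: prodr_gt0 => j _; case/andP: (H j).
by apply: prodr_ile1 => j; case/andP: (H j) => /ltW -> ->.
Qed.

Lemma zeta_form_bounds (R : realType) (a s M : nat) : (0 < a)%N -> (2 <= s)%N ->
  0 < \sum_(i < size (vanish_poly a M))
    ((vanish_poly a M)`_i)%:~R * zeta ((a * i + s)%:R : R)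
    <= zeta (2%:R : R) * M.+1%:R ^- (s - 2).
Proof.
move=> a0 s2; set L := \sum_(i < _) _.
pose p : {poly R} := map_poly intr (vanish_poly a M).
pose f m : R := m.+1%:R ^- s * p.[m.+1%:R ^- a].
have fL : series f @ \oo --> L.
  have := cvg_series_zeta_poly R p a s s2.
  rewrite size_map_inj_poly//; last exact: intr_inj.
  by under eq_bigr do rewrite coef_map.
have f_ge0 m : 0 <= f m.
  rewrite mulr_ge0 ?invr_ge0 ?exprn_ge0//; have [mM|Mm] := ltnP m M.
    by rewrite vanish_poly_eq0.
  by have /andP[/ltW] := vanish_poly_itv R a M m a0 Mm.
rewrite -(cvg_lim (@norm_hausdorff _ _) fL); apply/andP; split.
  (* All terms are nonnegative, and the term of index [M], the first that does not vanish, is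
     already positive. *)
  apply: lt_le_trans (nondecreasing_cvgn_le _ (cvgP _ fL) M.+1).
    rewrite /series /= big_nat_recr//= ltr_wpDl ?sumr_ge0//.
    rewrite mulr_gt0 ?invr_gt0 ?exprn_gt0//.
    by have /andP[] := vanish_poly_itv R a M M a0 (leqnn _).
  exact: nondecreasing_series.
(* For [M <= m], splitting off [m.+1%:R ^- 2] leaves [m.+1%:R ^- (s - 2)], which is at most
   [M.+1%:R ^- (s - 2)]. *)
have gL : series (fun m => m.+1%:R ^- 2 * M.+1%:R ^- (s - 2) : R) @ \oo -->
    zeta (2%:R : R) * M.+1%:R ^- (s - 2).
  rewrite (_ : series _ =
    (fun N => series (fun m => m.+1%:R ^- 2) N * M.+1%:R ^- (s - 2))).
    by apply: cvgMr_tmp; exact: cvg_series_zeta.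
  by apply/funext => N; rewrite /series /= mulr_suml.
rewrite -(cvg_lim (@norm_hausdorff _ _) gL).
apply: lim_series_le (cvgP _ fL) (cvgP _ gL) _ => m.
have [mM|Mm] := ltnP m M.
  by rewrite /f vanish_poly_eq0// mulr0 mulr_ge0// invr_ge0 exprn_ge0.
have /andP[p0 p1] := vanish_poly_itv R a M m a0 Mm.
apply: le_trans (ler_wpM2l _ p1) _; first by rewrite invr_ge0 exprn_ge0.
rewrite mulr1 -[in leLHS](subnKC s2) exprD invfM ler_wpM2l ?invr_ge0 ?exprn_ge0//.
by rewrite lef_pV2 ?posrE ?exprn_gt0// lerXn2r ?nnegrE// ler_nat.
Qed.

Lemma common_denom_q (R : realType) (a b n : nat) :
  common_denom R a b n (q_ R a b n).
Proof. by rewrite /q_; case: ex_minnP => q /andP[_ /asboolP]. Qed.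

Lemma q_lower_bound (R : realType) (a b N M n : nat) :
    (0 < a)%N -> (0 < b)%N ->
    (forall k, (N < k)%N -> rational (zeta ((a * k + b)%:R : R))) ->
    (M + N + 1 < n)%N ->
  M.+1%:R ^+ n <= (q_ R a b n)%:R * (zeta (2%:R : R) * M.+1%:R ^+ M.+1).
Proof.
move=> a0 b0 rat_zeta Nn.
have s2 : (2 <= a * (n - M) + b)%N by nia.
have := zeta_form_bounds R a _ M a0 s2.
set L := \sum_(i < _) _ => /andP[L0 LZ].
set q := q_ R a b n; set Z := zeta _ in LZ *.
have qL_int : q%:R * L \is a Num.int.
  rewrite mulr_sumr rpred_sum// => i _; rewrite mulrCA rpredM ?intr_int//.
  have iM : (i < M.+1)%N := leq_trans (ltn_ord i) (size_vanish_poly a M).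
  (* The index [k = n - M + i] satisfies [N < k <= n], so [q] clears this zeta value. *)
  rewrite (_ : a * i + _ = a * (n - M + i) + b)%N; last by lia.
  by apply: common_denom_q; [lia|apply: rat_zeta; lia].
have q0 : (0 < q)%N by rewrite /q /q_; case: ex_minnP => ? /andP[].
have qL0 : 0 < q%:R * L by rewrite mulr_gt0 ?ltr0n.
have := norm_intr_ge1 qL_int (lt0r_neq0 qL0); rewrite (gtr0_norm qL0) => qL1.
have K0 k : 0 < M.+1%:R ^+ k :> R by rewrite exprn_gt0.
have : M.+1%:R ^+ (a * (n - M) + b - 2) <= q%:R * Z.
  rewrite -[leLHS]mul1r -ler_pdivlMr// -mulrA.
  by apply: le_trans qL1 _; rewrite ler_wpM2l.
rewrite -(ler_pM2r (K0 M.+1)) -mulrA -exprD; apply: le_trans.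
(* As [a] and [b] are at least 1, [a * (n - M) + b - 2 + M.+1] is at least [n]: the factor
   [M.+1%:R ^+ M.+1] makes up for the exponent lost. *)
by rewrite ler_weXn2l ?ler1n//; nia.
Qed.

Theorem theorem1 (R : realType) (a b : nat) (ha : (0 < a)%N) (hb : (0 < b)%N) :
  infinite_set
    [set n : nat | (0 < n)%N /\ irrational (zeta (a * n + b)%:R : R)] \/
  (fun n : nat => (q_ R a b n)%:R `^ (n%:R^-1) : R) @ \oo --> +oo.
Proof.
have [|/contrapT/finite_seqP[s sE]] := pselect (infinite_set
    [set n : nat | (0 < n)%N /\ irrational (zeta (a * n + b)%:R : R)]).
  by left.
right; pose N := (\max_(i <- s) i)%N.
have rat_zeta k : (N < k)%N -> rational (zeta ((a * k + b)%:R : R)).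
  move=> Nk; apply: contrapT => irr.
  have : [set` s] k by rewrite -sE; split=> //; lia.
  move=> /= ks; have := @leq_bigmax_seq _ s xpredT id k ks isT.
  by rewrite leqNgt Nk.
apply/cvgryPge => A.
pose B := (Num.bound `|A|).+1.
have AB : A <= B%:R.
  apply: le_trans (ler_norm _) (ltW (lt_le_trans (archi_boundP _) _)) => //.
  by rewrite ler_nat.
(* Since [B] is positive, [M.+1 = 2 * B]. The lower bound then reads [(2 * B) ^ n <= q_n * C], and
   the spare [2 ^ n] absorbs the constant [C] for large [n]. *)
pose M := (2 * B).-1; pose C : R := zeta (2%:R : R) * M.+1%:R ^+ M.+1.
near=> n.
have Nn : (M + N + 1 < n)%N by near: n; exact: nbhs_infty_gt.
have Cn : C < 2 ^+ n.
  by apply: upper_nthrootP; near: n; exact: nbhs_infty_ge.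
have Bq : B%:R ^+ n <= (q_ R a b n)%:R :> R.
  rewrite -(ler_pM2r (_ : 0 < 2 ^+ n)) ?exprn_gt0// -exprMn.
  have := q_lower_bound R a b N M n ha hb rat_zeta Nn.
  rewrite -/C (_ : M.+1 = B * 2)%N ?natrM; last by lia.
  by move=> /le_trans; apply; rewrite ler_wpM2l// ltW.
apply: le_trans AB _.
(* Writing [B] as an n-th root, with [n] nonzero by [Nn], reduces the goal to [Bq] by
   monotonicity. *)
have -> : B%:R = (B%:R ^+ n) `^ n%:R^-1 :> R.
  by rewrite -powR_mulrn// -powRrM mulfV ?powRr1// pnatr_eq0; lia.
by rewrite ge0_ler_powR ?nnegrE ?exprn_ge0 ?invr_ge0.
Unshelve. all: by end_near. Qed.
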